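(* Let $\kappa\in\mathbb Z$ with $\kappa\le0$. Let $X$ be a union of cosets $B(\mathbb Z)\chi$ of $B(\mathbb Z)$ in $G(\mathbb Q)$, let $\mu=-g/h$ for some positive integers $g,h$ with $(g,h)=1$, and let $U=\{B(h\mathbb Z)\chi\mid\chi\in X\}$. Suppose that the normalized fractional Rademacher sum $T^{\kappa(\mu)}_U(z)$ and the modified fractional Rademacher sum $Q^{\kappa(\mu)}_U(z)$ converge. Then they vanish identically unless $h=1$.
   Context: $\mathbb H$ is the upper half plane, $e(z)=\exp(2\pi i z)$. $G(\mathbb Q)$ is the image of $PGL_2^+(\mathbb Q)$ in $PSL_2(\mathbb R)$ (rescale to determinant 1), acting by Möbius transformations on $\mathbb H\cup\mathbb Q\cup\{\infty\}$. For a positive integer $h$, $B(h\mathbb Z)$ is the group generated by $z\mapsto z+h$; $B(\mathbb Z)=B(1\mathbb Z)$. Each $\chi\in G(\mathbb Q)$ is represented, uniquely up to sign, by an integer matrix $\begin{pmatrix}a&b\\c&d\end{pmatrix}$ with coprime entries and positive determinant; put $c(\chi)=|c|$, $d(\chi)=|d|$, $\mathrm{jac}(\chi,z)=(ad-bc)/(cz+d)^2$. Fractional Rademacher sums. Let $\kappa\le0$ be an integer and $\mu=-g/h$ with $g,h$ coprime positive integers. For $z\in\mathbb H$, $\Re(s)>1$, with principal branches of powers and $x^{(s)}=x^s/\Gamma(s+1)$ ($\Gamma(\cdot)$ the Gamma function), put $$T_\chi^{\kappa(\mu)}(z,s)=e(\mu\chi\infty)\Big(\sum_{k\ge0}(2\pi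 i(\mu\chi z-\mu\chi\infty))^{(k+s-2\kappa)}\Big)\mathrm{jac}(\chi,z)^\kappa$$ if $c(\chi)\neq0$, $T_\chi^{\kappa(\mu)}(z,s)=e(\mu\chi z)\,\mathrm{jac}(\chi,z)^\kappa$ if $c(\chi)=0$; and $$T_{0,\chi}^{\kappa(\mu)}(s)=e(\mu\chi\infty)\,\mathrm{jac}(\chi,0)^\kappa\Big[(2\pi i(\mu\chi 0-\mu\chi\infty))^{(s-2\kappa)}-e(s/2)(2\pi i(\mu\chi\infty-\mu\chi0))^{(s-2\kappa)}\Big]$$ if $c(\chi)d(\chi)\ne0$, $T_{0,\chi}^{\kappa(\mu)}(s)=0$ otherwise. These depend only on the coset $B(h\mathbb Z)\chi$. For a set $U$ of cosets $B(h\mathbb Z)\chi$ in $G(\mathbb Q)$ put $$T_U^{\kappa(\mu)}(z,s)=\sum_{B(h\mathbb Z)\chi\in U}T_\chi^{\kappa(\mu)}(z,s),\qquad Q_U^{\kappa(\mu)}(z,s)=\sum_{B(h\mathbb Z)\chi\in U}\big(T_\chi^{\kappa(\mu)}(z,s)-T_{0,\chi}^{\kappa(\mu)}(s)\big),$$ when these sums converge absolutely and locally uniformly (for $\Re(s)>1$), and then $T_U^{\kappa(\mu)}(z)=\lim_{s\to1^+}T_U^{\kappa(\mu)}(z,s)$ and $Q_U^{\kappa(\mu)}(z)=\lim_{s\to1^+}Q_U^{\kappa(\mu)}(z,s)$, when these limits exist. ''Converge'' in the claim means that the sums and limits exist in this sense. *)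

(* Defs.v *)
From HB Require Import structures.
From mathcomp Require Import all_boot all_order all_algebra.
From mathcomp Require Import all_classical all_reals all_analysis.
From mathcomp Require Import complex.

Set Implicit Arguments.
Unset Strict Implicit.
Unset Printing Implicit Defensive.

Import Order.TTheory GRing.Theory Num.Theory.
Import numFieldNormedType.Exports.

Local Open Scope classical_set_scope.
Local Open Scope ring_scope.
Local Open Scope complex_scope.

(* [R[i]^o] is [R[i]] with its topology as a normed field. *)

Definition cexp (R : realType) (z : R[i]) : R[i] :=
  (expR (complex.Re z))%:C * (cos (complex.Im z) +i* sin (complex.Im z)).

(* Principal argument, with values in ]-pi, pi]. *)
Definition carg (R : realType) (z : R[i]) : R :=
  let t := acos (complex.Re z / ComplexField.Normc.normc z) in
  if 0 <= complex.Im z then t else - t.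

Definition clog (R : realType) (z : R[i]) : R[i] :=
  ln (ComplexField.Normc.normc z) +i* carg z.

(* Principal branch of w^s; only meaningful for w != 0. *)
Definition cpow (R : realType) (w s : R[i]) : R[i] := cexp (s * clog w).

(* Euler's integral for the Gamma function, computed on real and imaginary
   parts; only meaningful for Re z > 0. *)
Definition Gamma (R : realType) (z : R[i]) : R[i] :=
  let f (t : R) := cpow t%:C (z - 1) * (expR (- t))%:C in
  Rintegral lebesgue_measure `]0, +oo[ (fun t => complex.Re (f t))
  +i* Rintegral lebesgue_measure `]0, +oo[ (fun t => complex.Im (f t)).

Definition gpow (R : realType) (x s : R[i]) : R[i] := cpow x s / Gamma (s + 1).

Definition twopii (R : realType) : R[i] := (pi *+ 2) *i.

Definition e_ (R : realType) (z : R[i]) : R[i] := cexp (twopii R * z).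

Definition upper_half_plane (R : realType) : set R[i] :=
  [set z | 0 < complex.Im z].

(* An element of PSL_2(R) is the set {A, -A} for some A in SL_2(R); the product
   of PSL_2(R) is then the pointwise product of sets of matrices. *)
Definition psl2 (R : realType) := set 'M[R]_2.

Definition psl2_class (R : realType) (A : 'M[R]_2) : psl2 R := [set A; - A].

Definition psl2_mul (R : realType) (x y : psl2 R) : psl2 R :=
  [set A *m B | A in x & B in y].

(* Rescaling to determinant 1; only meaningful for 0 < \det A. *)
Definition psl2_rescale (R : realType) (A : 'M[R]_2) : psl2 R :=
  psl2_class ((Num.sqrt (\det A))^-1 *: A).

Definition GQ (R : realType) : set (psl2 R) :=
  [set psl2_rescale (map_mx ratr M) | M in [set M : 'M[rat]_2 | 0 < \det M]].
Arguments GQ : clear implicits.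

Definition Bgroup (R : realType) (h : nat) : set (psl2 R) :=
  [set psl2_class (1%:M + (h%:Z * n)%:~R *: delta_mx 0 1) | n in [set: int]].
Arguments Bgroup : clear implicits.

Definition Bcoset (R : realType) (h : nat) (chi : psl2 R) : set (psl2 R) :=
  [set psl2_mul b chi | b in Bgroup R h].

Definition represents (R : realType) (M : 'M[int]_2) (chi : psl2 R) : Prop :=
  [/\ \big[gcdn/0%N]_(i < 2) \big[gcdn/0%N]_(j < 2) `|M i j|%N = 1%N,
      0 < \det M & psl2_rescale (map_mx intr M) = chi].

(* The coprime integer matrix representing an element of G(Q), with an
   arbitrary choice of its sign. *)
Definition irep (R : realType) (chi : psl2 R) : 'M[int]_2 :=
  xget 1%:M [set M | represents M chi].

Definition cc (R : realType) (chi : psl2 R) : nat := absz (irep chi 1 0).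

Definition dd (R : realType) (chi : psl2 R) : nat := absz (irep chi 1 1).

(* Only meaningful when cz + d != 0, in particular on the upper half plane,
   and at z = 0 when d(chi) != 0. *)
Definition moebius (R : realType) (chi : psl2 R) (z : R[i]) : R[i] :=
  let M := irep chi in
  ((M 0 0)%:~R * z + (M 0 1)%:~R) / ((M 1 0)%:~R * z + (M 1 1)%:~R).

(* chi oo; only meaningful when c(chi) != 0, that is when chi oo != oo. *)
Definition moebius_oo (R : realType) (chi : psl2 R) : R[i] :=
  let M := irep chi in (M 0 0)%:~R / (M 1 0)%:~R.

Definition jac (R : realType) (chi : psl2 R) (z : R[i]) : R[i] :=
  let M := irep chi in
  (\det M)%:~R / ((M 1 0)%:~R * z + (M 1 1)%:~R) ^+ 2.

Definition Tterm (R : realType) (kappa : int) (mu : R) (chi : psl2 R)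
    (z s : R[i]) : R[i] :=
  if cc chi == 0%N then e_ (mu%:C * moebius chi z) * jac chi z ^ kappa
  else
    let w := twopii R * (mu%:C * moebius chi z - mu%:C * moebius_oo chi) in
    e_ (mu%:C * moebius_oo chi)
    * lim (series (fun k : nat =>
        gpow w (k%:R + s - 2 * kappa%:~R) : R[i]^o) @ \oo)
    * jac chi z ^ kappa.

Definition T0term (R : realType) (kappa : int) (mu : R) (chi : psl2 R)
    (s : R[i]) : R[i] :=
  if (cc chi * dd chi == 0)%N then 0
  else
    let v := mu%:C * moebius chi 0 - mu%:C * moebius_oo chi in
    let p := s - 2 * kappa%:~R in
    e_ (mu%:C * moebius_oo chi) * jac chi 0 ^ kappa
    * (gpow (twopii R * v) p - e_ (s / 2) * gpow (twopii R * - v) p).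

(* The finite subsets of U, directed by inclusion; the unordered sum [usum] is
   the limit of the finite partial sums along this filter. *)
Definition finsets_filter (I : choiceType) (U : set I) : set_system (set I) :=
  filter_from (fsets U) (fun A => [set B | fsets U B /\ A `<=` B]).

Definition usum (R : realType) (I : choiceType) (U : set I) (f : I -> R[i]) :
    R[i] :=
  lim ((fun A : set I => \sum_(i \in A) f i : R[i]^o) @ finsets_filter U).

Definition converges_absolutely (R : realType) (I : choiceType) (U : set I)
    (f : I -> R[i]) : Prop :=
  (\esum_(i in U) (ComplexField.Normc.normc (f i))%:E < +oo)%E.

Definition converges_locally_uniformly (R : realType) (I : choiceType)
    (U : set I) (f : I -> R[i] -> R[i]) : Prop :=
  forall z0 : R[i]^o, upper_half_plane z0 ->
  exists2 W : set R[i]^o, nbhs z0 W &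
    {uniform W `&` upper_half_plane (R := R),
      (fun (A : set I) (z : R[i]^o) => \sum_(i \in A) f i z : R[i]^o)
        @ finsets_filter U --> (fun z : R[i]^o => usum U (f^~ z) : R[i]^o)}.

(* The terms depend only on the coset B(hZ)chi, so they are evaluated at an
   arbitrarily chosen element of it. *)
Definition coset_repr (R : realType) (u : set (psl2 R)) : psl2 R := xget set0 u.

Definition Tcoset (R : realType) (kappa : int) (mu : R) (u : set (psl2 R))
    (z s : R[i]) : R[i] :=
  Tterm kappa mu (coset_repr u) z s.

Definition Qcoset (R : realType) (kappa : int) (mu : R) (u : set (psl2 R))
    (z s : R[i]) : R[i] :=
  Tterm kappa mu (coset_repr u) z s - T0term kappa mu (coset_repr u) s.

Definition sum_at_one (R : realType) (I : choiceType) (U : set I)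
    (F : I -> R[i] -> R[i] -> R[i]) (z : R[i]) : R[i] :=
  lim ((fun s : R => usum U (fun u => F u z s%:C) : R[i]^o) @ (1 : R)^'+).

(* Local uniformity is in z, for each fixed s with Re s > 1. *)
Definition sum_converges (R : realType) (I : choiceType) (U : set I)
    (F : I -> R[i] -> R[i] -> R[i]) : Prop :=
  (forall s : R[i], 1 < complex.Re s ->
     (forall z, upper_half_plane z -> converges_absolutely U (fun u => F u z s))
     /\ converges_locally_uniformly U (fun u z => F u z s))
  /\ (forall z, upper_half_plane z ->
        cvg ((fun s : R => usum U (fun u => F u z s%:C) : R[i]^o)
               @ (1 : R)^'+)).

Definition rademacher (R : realType) (kappa : int) (mu : R)
    (U : set (set (psl2 R))) (z : R[i]) : R[i] :=
  sum_at_one U (Tcoset kappa mu) z.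

Definition rademacher_converges (R : realType) (kappa : int) (mu : R)
    (U : set (set (psl2 R))) : Prop :=
  sum_converges U (Tcoset kappa mu).

Definition modified_rademacher (R : realType) (kappa : int) (mu : R)
    (U : set (set (psl2 R))) (z : R[i]) : R[i] :=
  sum_at_one U (Qcoset kappa mu) z.

Definition modified_rademacher_converges (R : realType) (kappa : int) (mu : R)
    (U : set (set (psl2 R))) : Prop :=
  sum_converges U (Qcoset kappa mu).

(* Main.v *)
(* Left translation by z |-> z + n permutes the cosets in U and multiplies each
   term T_chi and T_{0,chi} by e(mu n), so both sums are multiplied by e(mu n)
   under a reindexing and vanish as soon as e(mu n) != 1. If h > 1, such an n
   exists: take n g = 1 mod h, so that e(mu n) = e(- 1 / h). *)
Require Import Defs.
From HB Require Import structures.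
From mathcomp Require Import all_boot all_order all_algebra.
From mathcomp Require Import all_classical all_reals all_analysis.
From mathcomp Require Import complex ring.

Set Implicit Arguments.
Unset Strict Implicit.
Unset Printing Implicit Defensive.

Import Order.TTheory GRing.Theory Num.Theory.
Import numFieldNormedType.Exports.

Local Open Scope classical_set_scope.
Local Open Scope ring_scope.
Local Open Scope complex_scope.

(** * The character [e_] at real and integer arguments *)

Lemma cexpD (R : realType) (a b : R[i]) : cexp (a + b) = cexp a * cexp b.
Proof.
case: a b => [a1 a2] [b1 b2]; rewrite /cexp /= expRD cosD sinD.
apply/eqP; rewrite eq_complex /=; apply/andP; split; apply/eqP; ring.
Qed.

Lemma e_D (R : realType) (a b : R[i]) : e_ (a + b) = e_ a * e_ b.
Proof. by rewrite /e_ mulrDr cexpD. Qed.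

Lemma e_real (R : realType) (x : R) :
  e_ x%:C = cos ((pi *+ 2) * x) +i* sin ((pi *+ 2) * x).
Proof.
rewrite /e_ /cexp /twopii /=.
apply/eqP; rewrite eq_complex /= !(mul0r, mulr0, subr0, addr0, add0r, oppr0).
by rewrite expR0 !mul1r !eqxx.
Qed.

Lemma e_int (R : realType) (n : int) : e_ (n%:~R : R[i]) = 1.
Proof.
have e_nat (m : nat) : e_ (m%:R : R[i]) = 1.
  elim: m => [|m IH].
    by rewrite -[0%:R]/((0 : R)%:C) e_real mulr0 cos0 sin0.
  rewrite -addn1 natrD e_D IH mul1r -[1%:R]/((1 : R)%:C) e_real mulr1.
  by rewrite cos2pi mulr2n sinDpi sinpi oppr0.
case: n => m; first exact: e_nat.
rewrite NegzE mulrNz -[LHS]mul1r -{1}(e_nat m.+1) -e_D subrr.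
exact: (e_nat 0%N).
Qed.

(** The real part already differs from 1: for h at least 2 the angle 2 pi / h lies in ]0, pi], and
    cosine is injective on [0, pi]. *)
Lemma e_inv_neq1 (R : realType) (h : nat) :
  (1 < h)%N -> e_ (- (h%:R : R)^-1)%:C != 1.
Proof.
move=> h1; have h0 : 0 < (h%:R : R) by rewrite ltr0n ltnW.
rewrite e_real eq_complex /= negb_and; apply/orP; left.
rewrite mulrN cosN -[X in _ == X]cos0; apply/negP => /eqP /cos_inj.
rewrite !in_itv /= lexx pi_ge0 => /(_ _ isT) H.
have pos : 0 < (pi *+ 2) / (h%:R : R).
  by rewrite divr_gt0 // pmulrn_lgt0 // pi_gt0.
suff : (pi *+ 2) / (h%:R : R) = 0 by move=> E; rewrite E ltxx in pos.
apply: H; rewrite ltW //= ler_pdivrMr // -[pi *+ 2]mulr_natr ler_pM2l ?pi_gt0 //.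
by rewrite ler_nat.
Qed.

(** * Integer translations as unipotent matrices, acting on PSL_2(R) and G(Q) *)

Lemma det_mx22 (K : comNzRingType) (A : 'M[K]_2) :
  \det A = A 0 0 * A 1 1 - A 0 1 * A 1 0.
Proof.
rewrite (expand_det_row _ 0) !big_ord_recl big_ord0 addr0 /cofactor !det_mx11.
rewrite !mxE /= expr0 expr1 mul1r mulN1r mulrN.
by congr (A _ _ * A _ _ - A _ _ * A _ _); apply/val_inj.
Qed.

(** The matrix of z |-> z + n, in the very form used by [Bgroup]. The ring varies because elements
    of G(Q) come from rational matrices, their representatives from integer ones. *)
Definition unip (K : pzRingType) (n : int) : 'M[K]_2 :=
  1%:M + n%:~R *: delta_mx 0 1.

Lemma unipD (K : comNzRingType) (m n : int) :
  unip K m *m unip K n = unip K (m + n).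
Proof.
rewrite /unip mulmxDl mul1mx mulmxDr mulmx1 -scalemxAr -scalemxAl.
by rewrite mul_delta_mx_0 // !scaler0 addr0 rmorphD /= scalerDl addrA addrAC.
Qed.

Lemma unip0 (K : pzRingType) : unip K 0 = 1%:M.
Proof. by rewrite /unip scale0r addr0. Qed.

Lemma map_unip (K L : pzRingType) (f : {rmorphism K -> L}) (n : int) :
  map_mx f (unip K n) = unip L n.
Proof. by rewrite /unip map_mxD map_mx1 map_mxZ map_delta_mx rmorph_int. Qed.

Lemma unip_mulE (K : pzRingType) (n : int) (A : 'M[K]_2) :
  ((unip K n *m A) 0 =1 fun j => A 0 j + n%:~R * A 1 j)
  * ((unip K n *m A) 1 =1 A 1).
Proof.
split=> j; rewrite mxE !big_ord_recl big_ord0 !mxE /=.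
  have -> : lift 0 0 = 1 :> 'I_2 by apply/val_inj.
  by rewrite !(mulr0, mulr1, mul0r, mul1r, addr0, add0r).
have -> : lift 0 0 = 1 :> 'I_2 by apply/val_inj.
by rewrite !(mulr0, mulr1, mul0r, mul1r, addr0, add0r).
Qed.

Lemma det_unip (K : comNzRingType) (n : int) : \det (unip K n) = 1.
Proof.
rewrite det_mx22 /unip !mxE /=.
by rewrite !(mulr0, mulr1, mul0r, mul1r, addr0, add0r, subr0).
Qed.

Definition shift (R : realType) (n : int) : psl2 R -> psl2 R :=
  psl2_mul (psl2_class (unip R n)).

Lemma shift_class (R : realType) (n : int) (A : 'M[R]_2) :
  shift n (psl2_class A) = psl2_class (unip R n *m A).
Proof.
apply/seteqP; split=> [_ [B [->|->]] [C [->|->]] <-|_ [->|->]] /=.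
- by left.
- by right; rewrite mulmxN.
- by right; rewrite mulNmx.
- by left; rewrite mulmxN mulNmx opprK.
- by exists (unip R n); [left|exists A; first by left].
- exists (unip R n); [by left|exists (- A); first by right].
  by rewrite mulmxN.
Qed.

Lemma shift_rescale (R : realType) (n : int) (A : 'M[R]_2) :
  shift n (psl2_rescale A) = psl2_rescale (unip R n *m A).
Proof.
by rewrite /psl2_rescale shift_class det_mulmx det_unip mul1r scalemxAr.
Qed.

Lemma shift_map_rescale (R : realType) (K : comNzRingType)
    (f : {rmorphism K -> R}) (n : int) (M : 'M[K]_2) :
  shift n (psl2_rescale (map_mx f M)) = psl2_rescale (map_mx f (unip K n *m M)).
Proof. by rewrite shift_rescale map_mxM map_unip. Qed.

Lemma GQ_shift (R : realType) (n : int) (chi : psl2 R) :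
  GQ R chi -> GQ R (shift n chi).
Proof.
case=> M M0 <-; exists (unip rat n *m M); last by rewrite shift_map_rescale.
by rewrite /= det_mulmx det_unip mul1r.
Qed.

Lemma shiftD (R : realType) (m n : int) (chi : psl2 R) :
  GQ R chi -> shift m (shift n chi) = shift (m + n) chi.
Proof. by case=> M _ <-; rewrite !shift_rescale mulmxA unipD. Qed.

(** A member of [psl2 R] may be any set of matrices, and only one closed under negation is fixed by
    multiplication by {1, -1}; elements of [GQ R] are so. *)
Lemma shift0 (R : realType) (chi : psl2 R) : GQ R chi -> shift 0 chi = chi.
Proof. by case=> M _ <-; rewrite shift_rescale unip0 mul1mx. Qed.

(** * Primitive integer representatives, and their change under translation *)

Lemma psl2_rescaleZ (R : realType) (l : R) (A : 'M[R]_2) :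
  0 < l -> psl2_rescale (l *: A) = psl2_rescale A.
Proof.
move=> l0; rewrite /psl2_rescale detZ sqrtrM ?sqr_ge0 // sqrtr_sqr.
by rewrite gtr0_norm // scalerA invfM mulrAC mulVf ?mul1r // gt_eqF.
Qed.

Lemma rat_mx_scale (m n : nat) (M : 'M[rat]_(m, n)) :
  exists d : int, exists2 N : 'M[int]_(m, n),
    0 < d & map_mx intr N = d%:~R *: M.
Proof.
pose D (p : 'I_m * 'I_n) := denq (M p.1 p.2).
exists (\prod_p D p).
(* Multiplying an entry by the product of all denominators cancels its own denominator and keeps the
   others. *)
exists (\matrix_(i, j) (numq (M i j) * \prod_(p | p != (i, j)) D p)).
  by apply: prodr_gt0 => p _; exact: denq_gt0.
apply/matrixP => i j; rewrite !mxE [in RHS](bigD1 (i, j)) //= !intrM numqE.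
by rewrite [RHS]mulrC [RHS]mulrA.
Qed.

Lemma int_mx_primitive (N : 'M[int]_2) : 0 < \det N ->
  exists d : nat, exists2 M : 'M[int]_2, (0 < d)%N &
    \big[gcdn/0%N]_(i < 2) \big[gcdn/0%N]_(j < 2) `|M i j|%N = 1%N
    /\ N = d%:Z *: M.
Proof.
move=> N0.
pose d := \big[gcdn/0%N]_(i < 2) \big[gcdn/0%N]_(j < 2) `|N i j|%N.
have dN i j : (d%:Z %| N i j)%Z.
  by rewrite dvdzE /= (biggcdn_inf i) // (biggcdn_inf j).
pose M : 'M[int]_2 := \matrix_(i, j) (N i j %/ d%:Z)%Z.
have NM : N = d%:Z *: M.
  by apply/matrixP => i j; rewrite !mxE mulrC divzK.
clearbody M.
have d0 : (0 < d)%N.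
  rewrite lt0n; apply/negP => /eqP d0; move: N0.
  by rewrite NM d0 scale0r det0 ltxx.
(* Multiplication by d distributes over gcd, so d times the gcd of the entries of M is the gcd d of
   the entries of N; cancel d. *)
exists d, M => //; split => //; apply/eqP; rewrite -(eqn_pmul2l d0) muln1.
rewrite (big_morph _ (muln_gcdr d) (muln0 d)); apply/eqP.
apply: eq_bigr => i _; rewrite (big_morph _ (muln_gcdr d) (muln0 d)).
by apply: eq_bigr => j _; rewrite NM mxE abszM absz_nat.
Qed.

(** Ensures that [irep] never falls back on its default. Clearing denominators and dividing out the
    gcd of the entries only scale by positive numbers, which [psl2_rescale] ignores. *)
Lemma GQ_represents (R : realType) (chi : psl2 R) :
  GQ R chi -> represents (irep chi) chi.
Proof.
move=> chiG; suff /(xgetPex 1%:M) : exists M, represents M chi by [].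
case: chiG => A A0 <-.
have [d [N d0 NA]] := rat_mx_scale A.
have N0 : 0 < \det N.
  rewrite -(ltr0z rat) -det_map_mx NA detZ mulr_gt0 //.
  by rewrite exprn_gt0 // ltr0z.
have [k [M k0 [Mprim NM]]] := int_mx_primitive N0.
exists M; split=> //.
  by move: N0; rewrite NM detZ pmulr_rgt0 // exprn_gt0.
have k0R : 0 < (k%:R : R) by rewrite ltr0n.
have d0R : 0 < (d%:~R : R) by rewrite ltr0z.
rewrite -(psl2_rescaleZ _ k0R) -[RHS](psl2_rescaleZ _ d0R).
congr psl2_rescale; apply/matrixP => i j; rewrite !mxE.
have /matrixP/(_ i j) := NA; rewrite NM !mxE => /(congr1 (@ratr R)).
by rewrite !rmorphM /= !ratr_int.
Qed.

(** Both matrices rescale to the class of the translate, so they are proportional. The factor is the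
    ratio of the roots of their determinants up to sign, as [irep] fixes no sign. *)
Lemma irep_shift (R : realType) (n : int) (chi : psl2 R) : GQ R chi ->
  exists2 l : R, l != 0 & map_mx intr (irep (shift n chi)) =
    l *: map_mx intr (unip int n *m irep chi).
Proof.
move=> chiG; have [_ d0 chiE] := GQ_represents chiG.
have [_ d0' ] := GQ_represents (GQ_shift n chiG).
rewrite -{2}chiE shift_map_rescale.
set M' := irep (shift n chi); set M := unip _ _ *m _.
have M0 : 0 < \det M by rewrite det_mulmx det_unip mul1r.
have sqrt_det_gt0 (B : 'M[int]_2) : 0 < \det B ->
    0 < Num.sqrt (\det (map_mx intr B : 'M[R]_2)).
  by move=> B0; rewrite sqrtr_gt0 det_map_mx ltr0z.
have r0 := sqrt_det_gt0 _ M0; have r0' := sqrt_det_gt0 _ d0'.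
rewrite /psl2_rescale; set r' := Num.sqrt _ in r0' *.
set r := Num.sqrt _ in r0 * => E.
have : psl2_class (r'^-1 *: (map_mx intr M' : 'M[R]_2)) (r'^-1 *: map_mx intr M').
  by left.
rewrite E => -[|] /(congr1 (fun A => r' *: A)).
all: rewrite scalerA divff ?gt_eqF // scale1r => ->.
  by exists (r' / r); rewrite ?scalerA // mulf_neq0 ?invr_eq0 ?gt_eqF.
exists (- (r' / r)); first by rewrite oppr_eq0 mulf_neq0 ?invr_eq0 ?gt_eqF.
by rewrite scalerN scalerA scaleNr.
Qed.

(* Comparing the two representatives up to a nonzero factor suffices, since
   [moebius], [moebius_oo], [jac] and the vanishing of [cc] and [dd] are
   invariant under scaling. *)
Lemma irep_shift_entries (R : realType) (n : int) (chi : psl2 R) : GQ R chi ->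
  let M := irep chi in let M' := irep (shift n chi) in
  exists2 l : R[i], l != 0 & forall j,
    ((M' 0 j)%:~R = l * ((M 0 j)%:~R + n%:~R * (M 1 j)%:~R)) *
    ((M' 1 j)%:~R = l * (M 1 j)%:~R).
Proof.
move=> chiG M M'; have [l l0 /matrixP E] := irep_shift n chiG.
exists l%:C; first by rewrite -(rmorph0 (real_complex R)) (inj_eq (@complexI _)).
move=> j; have := E 0 j; rewrite mxE [in RHS]mxE [in RHS]mxE unip_mulE => E0.
have := E 1 j; rewrite mxE [in RHS]mxE [in RHS]mxE unip_mulE => E1.
split; rewrite -(rmorph_int (real_complex R)) (E0, E1) rmorphM rmorph_int //=.
by rewrite rmorphD rmorphM !rmorph_int.
Qed.

(** * Effect of a translation on the terms of the sums *)

Lemma cc_shift (R : realType) (n : int) (chi : psl2 R) : GQ R chi ->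
  (cc (shift n chi) == 0%N) = (cc chi == 0%N).
Proof.
move=> /(irep_shift_entries n) [l l0 /(_ 0) [_ E]].
by rewrite /cc !absz_eq0 -!(intr_eq0 R[i]) E mulf_eq0 (negPf l0).
Qed.

Lemma dd_shift (R : realType) (n : int) (chi : psl2 R) : GQ R chi ->
  (dd (shift n chi) == 0%N) = (dd chi == 0%N).
Proof.
move=> /(irep_shift_entries n) [l l0 /(_ 1) [_ E]].
by rewrite /dd !absz_eq0 -!(intr_eq0 R[i]) E mulf_eq0 (negPf l0).
Qed.

Lemma moebius_shift (R : realType) (n : int) (chi : psl2 R) (z : R[i]) :
  GQ R chi -> (irep chi 1 0)%:~R * z + (irep chi 1 1)%:~R != 0 ->
  moebius (shift n chi) z = moebius chi z + n%:~R.
Proof.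
move=> chiG cz; have [l l0 E] := irep_shift_entries n chiG.
by rewrite /moebius !E; field; rewrite cz -mulrA -mulrDr mulf_neq0.
Qed.

Lemma moebius_oo_shift (R : realType) (n : int) (chi : psl2 R) :
  GQ R chi -> cc chi != 0%N ->
  moebius_oo (shift n chi) = moebius_oo chi + n%:~R.
Proof.
move=> chiG c0; have [l l0 E] := irep_shift_entries n chiG.
have c0' : (irep chi 1 0)%:~R != 0 :> R[i] by rewrite intr_eq0 -absz_eq0.
by rewrite /moebius_oo !E; field; rewrite l0 c0'.
Qed.

Lemma jac_shift (R : realType) (n : int) (chi : psl2 R) (z : R[i]) :
  GQ R chi -> jac (shift n chi) z = jac chi z.
Proof.
move=> chiG; have [l l0 E] := irep_shift_entries n chiG.
rewrite /jac !det_mx22 !(intrM, rmorphB) /= !intrM !E.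
rewrite -[_ * _ * z]mulrA -[_ + l * _]mulrDr.
(* Where the denominator vanishes, both sides are quotients by zero, hence 0; elsewhere numerator
   and denominator both scale by l^2. *)
set q := _ * z + _; have [->|q0] := eqVneq q 0.
  by rewrite mulr0 expr0n invr0 !mulr0.
by field; rewrite l0 q0.
Qed.

(** The imaginary part of cz + d is c times that of z, so a zero would force c = 0, then d = 0 and a
    zero determinant. *)
Lemma denom_neq0 (R : realType) (chi : psl2 R) (z : R[i]) :
  GQ R chi -> upper_half_plane z ->
  (irep chi 1 0)%:~R * z + (irep chi 1 1)%:~R != 0.
Proof.
move=> /GQ_represents [_ d0 _] z0; apply/negP.
rewrite -!(rmorph_int (real_complex R)); case: z z0 => x y.
rewrite /upper_half_plane /= => y0.
rewrite eq_complex /= !(mul0r, subr0, addr0) => /andP[/eqP D /eqP C].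
have c0 : irep chi 1 0 = 0.
  apply/eqP; rewrite -(intr_eq0 R); move/eqP: C.
  by rewrite mulf_eq0 (gt_eqF y0) orbF.
have d1 : irep chi 1 1 = 0.
  by apply/eqP; rewrite -(intr_eq0 R) -D c0 mul0r add0r.
by move: d0; rewrite det_mx22 c0 d1 !mulr0 subrr ltxx.
Qed.

(** Both chi z and chi oo move by n, so their difference and the inner series are unchanged; only
    the exponential prefactor gains e(mu n). *)
Lemma Tterm_shift (R : realType) (kappa : int) (mu : R) (n : int)
    (chi : psl2 R) (z s : R[i]) : GQ R chi -> upper_half_plane z ->
  Tterm kappa mu (shift n chi) z s
  = e_ (mu%:C * n%:~R) * Tterm kappa mu chi z s.
Proof.
move=> chiG z0; rewrite /Tterm cc_shift // jac_shift //.
rewrite moebius_shift // ?denom_neq0 // ![mu%:C * (_ + _)]mulrDr.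
case: ifPn => c0; first by rewrite e_D mulrA [_ * e_ _]mulrC.
rewrite moebius_oo_shift // ![mu%:C * (_ + _)]mulrDr opprD addrACA subrr addr0.
by rewrite e_D [e_ _ * e_ _]mulrC -!(mulrA (e_ (mu%:C * n%:~R))).
Qed.

Lemma T0term_shift (R : realType) (kappa : int) (mu : R) (n : int)
    (chi : psl2 R) (s : R[i]) : GQ R chi ->
  T0term kappa mu (shift n chi) s = e_ (mu%:C * n%:~R) * T0term kappa mu chi s.
Proof.
move=> chiG; rewrite /T0term !muln_eq0 cc_shift // dd_shift // jac_shift //.
case: ifPn => [_|]; first by rewrite mulr0.
rewrite negb_or => /andP[c0 d0].
rewrite moebius_shift //; last by rewrite mulr0 add0r intr_eq0 -absz_eq0.
rewrite moebius_oo_shift // ![mu%:C * (_ + _)]mulrDr opprD addrACA subrr addr0.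
by rewrite e_D [e_ _ * e_ _]mulrC -!(mulrA (e_ (mu%:C * n%:~R))).
Qed.

(** * Translations acting on cosets *)

Lemma Bcoset_shift (R : realType) (h : nat) (chi : psl2 R) :
  Bcoset h chi = [set shift (h%:Z * n) chi | n in [set: int]].
Proof.
apply/seteqP; split=> [_ [_ [n _ <-] <-]|_ [n _ <-]]; first by exists n.
by exists (psl2_class (unip R (h%:Z * n))) => //; exists n.
Qed.

(** Integer translations commute, so left translation is well defined on left-multiplication cosets
    and is just the direct image. *)
Lemma image_shift_Bcoset (R : realType) (h : nat) (n : int) (chi : psl2 R) :
  GQ R chi -> shift n @` Bcoset h chi = Bcoset h (shift n chi).
Proof.
move=> chiG; rewrite !Bcoset_shift.
apply/seteqP; split=> [_ [_ [m _ <-] <-]|_ [m _ <-]].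
  by exists m => //; rewrite !shiftD // addrC.
by exists (shift (h%:Z * m) chi); [exists m|rewrite !shiftD // addrC].
Qed.

Lemma coset_repr_Bcoset (R : realType) (h : nat) (chi : psl2 R) :
  exists n, coset_repr (Bcoset h chi) = shift (h%:Z * n) chi.
Proof.
rewrite Bcoset_shift /coset_repr; set u := [set _ | _ in _].
have /(xgetPex set0) [n _ <-] : exists x, u x by exists (shift (h%:Z * 0) chi), 0.
by exists n.
Qed.

(** * Unordered sums and reindexing *)

Lemma finsets_filter_proper (I : choiceType) (U : set I) :
  ProperFilter (finsets_filter U).
Proof.
apply: filter_from_proper => [|A fA]; last by exists A; split.
apply: filter_from_filter => [|A B [finA AU] [finB BU]].
  by exists set0; split => //; exact: finite_set0.
exists (A `|` B); first by split; [rewrite finite_setU|rewrite subUset].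
by move=> C [fC]; rewrite subUset => -[AC BC]; split; split.
Qed.

(* Reindexing along the bijection [phi] multiplies the limit by [c]. *)
Lemma finsets_lim_eq0 (R : realType) (I : choiceType) (U : set I)
    (phi psi : I -> I) (f : I -> R[i]) (c l : R[i]) :
  (forall u, U u -> U (phi u)) -> (forall u, U u -> U (psi u)) ->
  (forall u, U u -> psi (phi u) = u) -> (forall u, U u -> phi (psi u) = u) ->
  (forall u, U u -> f (phi u) = c * f u) -> c != 1 ->
  (fun A : set I => \sum_(i \in A) f i : R[i]^o) @ finsets_filter U
    --> (l : R[i]^o) ->
  l = 0.
Proof.
move=> phiU psiU phiK psiK fphi c1 fl.
have ? := finsets_filter_proper U.
have phi_cvg : (fun A => phi @` A) @ finsets_filter U --> finsets_filter U.
  (* For phi(B) to contain A, it is enough that B contains psi(A). *)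
  move=> V [A [finA AU] AV]; exists (psi @` A).
    by split; [exact: finite_image|move=> _ [u Au <-]; apply/psiU/AU].
  move=> B [[finB BU] AB]; apply: AV; split.
    by split; [exact: finite_image|move=> _ [u Bu <-]; apply/phiU/BU].
  by move=> u Au; exists (psi u); [apply: AB; exists u|apply/psiK/AU].
have cfl : (fun A : set I => \sum_(i \in A) c * f i : R[i]^o) @ finsets_filter U
    --> (c * l : R[i]^o).
  by under eq_fun do rewrite -mulr_fsumr; exact: (cvgMr fl).
have lcl : l = c * l.
  (* The sum of f over phi(A) equals the sum of c f over A for every finite subset A of U, so the
     same net tends to l and to c l. *)
  apply: (cvg_unique (@norm_hausdorff _ R[i]^o) _ cfl).
  apply: (cvg_trans _ (cvg_comp _ _ phi_cvg fl)); apply: near_eq_cvg.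
  exists set0; first by split => //; exact: finite_set0.
  move=> A [[_ AU] _] /=; rewrite fsbig_image.
    by apply: eq_fsbigr => u /set_mem/AU Uu; rewrite fphi.
  by move=> u v /set_mem/AU Uu /set_mem/AU Uv E; rewrite -(phiK u) // E phiK.
have : (1 - c) * l = 0 by rewrite mulrBl mul1r -lcl subrr.
by move/eqP; rewrite mulf_eq0 subr_eq0 eq_sym (negPf c1) => /eqP.
Qed.

(** Uniform convergence near z restricts to the singleton {z}, where it is pointwise convergence. *)
Lemma locally_uniform_cvg (R : realType) (I : choiceType) (U : set I)
    (f : I -> R[i] -> R[i]) (z : R[i]) :
  converges_locally_uniformly U f -> upper_half_plane z ->
  (fun A : set I => \sum_(i \in A) f i z : R[i]^o) @ finsets_filter U
    --> (usum U (f^~ z) : R[i]^o).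
Proof.
move=> fU z0; have [W zW Wf] := fU z z0.
have ? := finsets_filter_proper U.
have zWH : [set z] `<=` W `&` upper_half_plane (R := R).
  by move=> _ ->; split=> //; exact: nbhs_singleton zW.
have := uniform_subset_cvg _ zWH Wf.
by rewrite uniform_set1; apply; exact: fmap_filter.
Qed.

(** The unordered sum already vanishes for each real s > 1, so the limit at 1 from the right is that
    of a function eventually equal to 0. *)
Lemma sum_at_one_eq0 (R : realType) (I : choiceType) (U : set I)
    (phi psi : I -> I) (F : I -> R[i] -> R[i] -> R[i]) (c z : R[i]) :
  (forall u, U u -> U (phi u)) -> (forall u, U u -> U (psi u)) ->
  (forall u, U u -> psi (phi u) = u) -> (forall u, U u -> phi (psi u) = u) ->
  (forall u s, U u -> F (phi u) z s = c * F u z s) -> c != 1 ->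
  sum_converges U F -> upper_half_plane z -> sum_at_one U F z = 0.
Proof.
move=> phiU psiU phiK psiK Fphi c1 [FU _] z0; rewrite /sum_at_one.
apply: (@cvg_lim R[i]^o (@norm_hausdorff _ _)); apply: cvg_near_cst; near=> s.
have s1 : 1 < complex.Re s%:C by rewrite /=; near: s; exact: nbhs_right_gt.
have [_ Fs] := FU _ s1.
apply: (finsets_lim_eq0 phiU psiU phiK psiK _ c1 (locally_uniform_cvg Fs z0)).
by move=> u Uu; exact: Fphi.
Unshelve. all: by end_near.
Qed.

Theorem proposition5p4p2 (R : realType) (kappa : int) (hkappa : kappa <= 0)
    (X : set (psl2 R))
    (hX : exists2 S : set (psl2 R), S `<=` GQ R &
            X = \bigcup_(chi in S) Bcoset 1 chi)
    (g h : nat) (hg : (0 < g)%N) (hh : (0 < h)%N) (hgh : coprime g h)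
    (mu : R) (hmu : mu = - (g%:R / h%:R))
    (U : set (set (psl2 R))) (hU : U = [set Bcoset h chi | chi in X])
    (hT : rademacher_converges kappa mu U)
    (hQ : modified_rademacher_converges kappa mu U) :
  h <> 1%N ->
  forall z : complex R, upper_half_plane z ->
    rademacher kappa mu U z = 0 /\ modified_rademacher kappa mu U z = 0.
Proof.
move=> h1 z z0.
have h_gt1 : (1 < h)%N by rewrite ltn_neqAle hh andbT eq_sym; apply/eqP.
have h_neq0 : (h%:R : R) != 0 by rewrite pnatr_eq0 -lt0n.
have [n en] : exists n : int, e_ (mu%:C * n%:~R : R[i]) != 1.
  (* Bezout gives m g = k h + 1, hence mu m = - 1 / h - k, and the integer k does not affect
     [e_]. *)
  case: (egcdnP h hg) => m k; rewrite (eqP hgh) => mk _.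
  exists m.
  have -> : mu%:C * m%:~R = (- (h%:R : R)^-1)%:C + (- (k%:Z))%:~R :> R[i].
    rewrite -!(rmorph_int (real_complex R)) -rmorphM -rmorphD /=; congr _%:C.
    have mkR : m%:R * g%:R = k%:R * h%:R + 1 :> R by rewrite -!natrM mk natrD.
    rewrite hmu mulrNz -!pmulrn mulNr mulrAC [_ * m%:R]mulrC mkR.
    by field.
  by rewrite e_D e_int mulr1 e_inv_neq1.
have XG chi : X chi -> GQ R chi.
  case: hX => S SG ->; case=> chi0 /SG chi0G; rewrite Bcoset_shift.
  by case=> m _ <-; exact: GQ_shift.
(* Here X being a union of cosets of the full group B(Z) is essential: n need not be a multiple of
   h. *)
have Xshift (m : int) chi : X chi -> X (shift m chi).
  case: hX => S SG ->; case=> chi0 Schi0; rewrite Bcoset_shift => -[k _ <-].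
  exists chi0 => //; rewrite Bcoset_shift; exists (m + k) => //.
  by rewrite shiftD ?mul1r //; exact: SG.
have Ushift m u : U u -> U (shift m @` u).
  rewrite hU => -[chi Xchi <-]; exists (shift m chi); first exact: Xshift.
  by rewrite image_shift_Bcoset //; exact: XG.
have UshiftK (k m : int) u : k + m = 0 -> U u -> shift k @` (shift m @` u) = u.
  rewrite hU => km [chi /XG chiG <-]; rewrite !image_shift_Bcoset //.
    by rewrite shiftD // km shift0.
  exact: GQ_shift.
(* Since mu h m = - g m is an integer, terms do not depend on the representative of a coset of
   B(hZ). *)
have emuh (m : int) : e_ (mu%:C * (h%:Z * m)%:~R : R[i]) = 1.
  rewrite -[RHS](e_int R (- (g%:Z * m))); congr e_.
  rewrite -!(rmorph_int (real_complex R)) -rmorphM /=; congr _%:C.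
  by rewrite hmu mulrNz !intrM -!pmulrn; field.
have FU (F : psl2 R -> R[i] -> R[i] -> R[i]) :
    (forall m chi s, GQ R chi ->
       F (shift m chi) z s = e_ (mu%:C * m%:~R) * F chi z s) ->
    forall u s, U u -> F (coset_repr (shift n @` u)) z s =
                       e_ (mu%:C * n%:~R) * F (coset_repr u) z s.
  move=> Fs u s; rewrite hU => -[chi /XG chiG <-].
  rewrite image_shift_Bcoset //.
  (* The representatives of the two cosets are chosen independently; each differs from [chi] or
     [shift n chi] by a multiple of h, which contributes the factor 1. *)
  have [m ->] := coset_repr_Bcoset h chi.
  have [k ->] := coset_repr_Bcoset h (shift n chi).
  by rewrite !Fs ?emuh ?mul1r //; exact: GQ_shift.
have sum0 (F : psl2 R -> R[i] -> R[i] -> R[i]) :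
    (forall m chi s, GQ R chi ->
       F (shift m chi) z s = e_ (mu%:C * m%:~R) * F chi z s) ->
    sum_converges U (fun u => F (coset_repr u)) ->
    sum_at_one U (fun u => F (coset_repr u)) z = 0.
  move=> /FU Fn Fcvg.
  (* Reindexing by the translation by n, with the translation by -n as its inverse on U. *)
  apply: (sum_at_one_eq0 (phi := image^~ (shift n))
    (psi := image^~ (shift (- n))) _ _ _ _ Fn) => //.
  - by move=> u Uu; exact: Ushift.
  - by move=> u Uu; exact: Ushift.
  - by move=> u Uu; apply: UshiftK; rewrite ?addNr.
  - by move=> u Uu; apply: UshiftK; rewrite ?subrr.
split.
  by apply: (sum0 (Tterm kappa mu) _ hT) => m chi s chiG; exact: Tterm_shift.
apply: (sum0 (fun chi w s => Tterm kappa mu chi w s - T0term kappa mu chi s)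
  _ hQ) => m chi s chiG.
by rewrite Tterm_shift // T0term_shift // -mulrBr.
Qed.
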